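(* Let $\{Q_k^{LSE}\}_{k\ge 0}$ be the (random) iterates of LSE soft Q-learning with constant step size $\alpha\in(0,1)$, parameter $\beta>0$, discount factor $\gamma\in[0,1)$, rewards bounded in absolute value by $1$, initial iterate satisfying $\|Q_0^{LSE}\|_\infty\le 1$, and i.i.d. sampling of state-action pairs from a distribution $d$ with $d(s,a)>0$ for all $(s,a)\in\mathcal S\times\mathcal A$. Let $Q^*$ be the optimal Q-function. Then for any $k\ge 0$, \[ \mathbb{E}\left[\left\|Q_k^{LSE}-Q^*\right\|_{\infty}\right] \le \frac{3\sqrt{6}\, \alpha^{1/2} d_{max} \left(\ln (|\mathcal{A}|)+\beta\right) |\mathcal{S} \times \mathcal{A}|}{\beta\, d_{min}^{3/2}(1-\gamma)^{5/2}} + \frac{4\alpha\gamma d_{max} |\mathcal{S} \times \mathcal{A}|^{3/2}}{1-\gamma}\, k \rho^{k-1} + \frac{\ln(|\mathcal{A}|)}{\beta d_{min}(1 - \gamma )} + \frac{2|\mathcal{S} \times \mathcal{A}|^{3/2}}{1-\gamma}\rho^k . \]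
   Context: MDP: finite state space $\mathcal S=\{1,\dots,|\mathcal S|\}$, finite action space $\mathcal A=\{1,\dots,|\mathcal A|\}$, transition probabilities $P(s'|s,a)$, reward function $r:\mathcal S\times\mathcal A\times\mathcal S\to\mathbb R$ with $\max_{s,a,s'}|r(s,a,s')|\le 1$, discount factor $\gamma\in[0,1)$. The optimal Q-function $Q^*\in\mathbb R^{|\mathcal S||\mathcal A|}$ is the unique solution of the Bellman optimality equation $Q^*(s,a)=\sum_{s'}P(s'|s,a)\left(r(s,a,s')+\gamma\max_{u\in\mathcal A}Q^*(s',u)\right)$. Sampling: $d$ is a probability distribution on $\mathcal S\times\mathcal A$ with $d(s,a)>0$ for all $(s,a)$ (for instance $d(s,a)=p(s)\pi_b(a|s)$ for a time-invariant behavior policy $\pi_b$ and stationary state distribution $p$). At each time $k\ge0$, $(s_k,a_k)\sim d$, independently and identically distributed over $k$, then $s_k'\sim P(\cdot|s_k,a_k)$ and $r_k=r(s_k,a_k,s_k')$; the tuples are independent over $k$. LSE operator: for $v\in\mathbb R^{|\mathcal A|}$ and $\beta>0$, $h_{LSE}^{\beta}(v)=\frac1\beta\ln\left(\sum_{a\in\mathcal A}\exp(\beta v(a))\right)$. LSE soft Q-learning: starting from a fixed (deterministic) $Q_0^{LSE}$ with $\|Q_0^{LSE}\|_\infty\le1$, set $Q_{k+1}^{LSE}(s_k,a_k)=Q_k^{LSE}(s_k,a_k)+\alpha\{r_k+\gamma h_{LSE}^\beta(Q_k^{LSE}(s_k',\cdot))-Q_k^{LSE}(s_k,a_k)\}$,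 all other entries of $Q_k^{LSE}$ being unchanged. Constants: $d_{max}=\max_{(s,a)}d(s,a)\in(0,1)$, $d_{min}=\min_{(s,a)}d(s,a)\in(0,1)$, $\rho=1-\alpha d_{min}(1-\gamma)\in(0,1)$; $|\mathcal S\times\mathcal A|=|\mathcal S||\mathcal A|$. *)

(* Defs.v *)
From HB Require Import structures.
From mathcomp Require Import all_boot all_order all_algebra.
From mathcomp Require Import all_classical all_reals all_analysis.

Set Implicit Arguments.
Unset Strict Implicit.
Unset Printing Implicit Defensive.

Import Order.TTheory GRing.Theory Num.Theory.
Import numFieldNormedType.Exports.

Local Open Scope classical_set_scope.
Local Open Scope ring_scope.

(* On a nonempty finite type the supremum and the infimum are attained
   (maxfP, minfP). On an empty type both are 0. *)
Definition maxf (R : realType) (T : finType) (f : T -> R) : R := sup (range f).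
Definition minf (R : realType) (T : finType) (f : T -> R) : R := inf (range f).

Lemma maxfP (R : realType) (T : finType) (f : T -> R) (x0 : T) :
  (exists x, maxf f = f x) /\ (forall y, f y <= maxf f).
Proof.
case: (@arg_maxP _ _ T x0 predT f isT) => x _ fx.
have ub : ubound (range f) (f x) by move=> _ [y _ <-]; exact: fx.
have le_max y : f y <= maxf f by apply: ub_le_sup; [exists (f x) | exists y].
split=> //; exists x; apply/eqP; rewrite eq_le le_max andbT.
by apply: ge_sup => //; exists (f x0), x0.
Qed.

Lemma minfP (R : realType) (T : finType) (f : T -> R) (x0 : T) :
  (exists x, minf f = f x) /\ (forall y, minf f <= f y).
Proof.
case: (@arg_minP _ _ T x0 predT f isT) => x _ fx.
have lb : lbound (range f) (f x) by move=> _ [y _ <-]; exact: fx.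
have ge_min y : minf f <= f y by apply: ge_inf; [exists (f x) | exists y].
split=> //; exists x; apply/eqP; rewrite eq_le ge_min /=.
by apply: lb_le_inf => //; exists (f x0), x0.
Qed.

Definition norm_inf (R : realType) (S A : finType) (Q : S -> A -> R) : R :=
  maxf (fun p : S * A => `|Q p.1 p.2|).

Definition is_dist (R : realType) (T : finType) (p : T -> R) : Prop :=
  (forall x, 0 <= p x) /\ \sum_(x : T) p x = 1.

(* P s a s' is the probability of moving from s to s' under a. *)
Definition is_transition (R : realType) (S A : finType)
    (P : S -> A -> S -> R) : Prop :=
  forall s a, is_dist (P s a).

(* For 0 <= gamma < 1 this equation has exactly one solution. *)
Definition is_optimal_Q (R : realType) (S A : finType) (P : S -> A -> S -> R)
    (r : S -> A -> S -> R) (gamma : R) (Q : S -> A -> R) : Prop :=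
  forall s a,
    Q s a = \sum_(s' : S) P s a s' * (r s a s' + gamma * maxf (Q s')).

Definition hLSE (R : realType) (A : finType) (beta : R) (v : A -> R) : R :=
  beta^-1 * ln (\sum_(a : A) expR (beta * v a)).

Definition lse_step (R : realType) (S A : finType) (r : S -> A -> S -> R)
    (gamma alpha beta : R) (Q : S -> A -> R) (x : S * A * S) : S -> A -> R :=
  let: (sk, ak, sk') := x in
  fun s a =>
    if (s == sk) && (a == ak) then
      Q s a + alpha * (r s a sk' + gamma * hLSE beta (Q sk') - Q s a)
    else Q s a.

(* The iterates along one trajectory, where x k = (s_k, a_k, s'_k). *)
Fixpoint lse_Q (R : realType) (S A : finType) (r : S -> A -> S -> R)
    (gamma alpha beta : R) (Q0 : S -> A -> R) (x : nat -> S * A * S)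
    (k : nat) {struct k} : S -> A -> R :=
  if k is j.+1 then
    lse_step r gamma alpha beta (lse_Q r gamma alpha beta Q0 x j) (x j)
  else Q0.

(* Mutual independence; T carries the discrete sigma-algebra. *)
Definition mutually_independent (disp : measure_display)
    (Omega : measurableType disp) (R : realType) (Pr : probability Omega R)
    (T : finType) (X : nat -> Omega -> T) : Prop :=
  forall (J : seq nat) (B : nat -> set T), uniq J ->
    Pr (\big[setI/setT]_(k <- J) (X k @^-1` B k)) =
    (\prod_(k <- J) Pr (X k @^-1` B k))%E.

(* (s_k, a_k) ~ d and s'_k ~ P(. | s_k, a_k), independently over k. *)
Definition iid_sampling (disp : measure_display) (Omega : measurableType disp)
    (R : realType) (Pr : probability Omega R) (S A : finType)
    (d : S -> A -> R) (P : S -> A -> S -> R)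
    (X : nat -> Omega -> S * A * S) : Prop :=
  [/\ forall k (B : set (S * A * S)), measurable (X k @^-1` B),
      forall k s a s',
        Pr (X k @^-1` [set (s, a, s')]) = (d s a * P s a s')%:E
    & mutually_independent Pr X].

(* Main.v *)
Require Import Defs.
From HB Require Import structures.
From mathcomp Require Import all_boot all_order all_algebra.
From mathcomp Require Import all_classical all_reals all_analysis.
From mathcomp Require Import measurable_realfun ring lra.

Set Implicit Arguments.
Unset Strict Implicit.
Unset Printing Implicit Defensive.

Import Order.TTheory GRing.Theory Num.Theory.
Import numFieldNormedType.Exports.

Local Open Scope classical_set_scope.
Local Open Scope ring_scope.

(* Split the error as Q_k - Qstar = drift + noise + residual, where
   drift + noise solves the linear system with matrix
   M = I - alpha D + alpha gamma D P Pi (Pi the greedy policy of Qstar) driven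
   by the martingale noise of the algorithm. The rows of the nonnegative matrix
   M sum to at most rho, so the drift decays like rho^k, and every linear
   functional of the noise has second moment at most
   alpha (2B)^2 / (dmin (1 - gamma)) times its squared l1 norm, where B bounds
   the iterates. The soft maximum dominates the value of the greedy action, so
   the residual is nonnegative, and it exceeds the maximum by at most ln |A| /
   beta, so the norm of the residual satisfies a scalar recursion with factor
   rho. Samples range over a finite set, so all expectations reduce to iterated
   finite averages over sample paths. *)

(** * Averages over finite sample paths *)

(** Expected value of [F] on [s] followed by [n] independent draws from [p]. Keeping the prefix [s]
    makes this a conditional expectation given the samples seen so far. *)
Fixpoint mean_path (R : realType) (T : finType) (p : T -> R) (n : nat)
    (F : seq T -> R) (s : seq T) {struct n} : R :=
  if n is m.+1 then \sum_x p x * mean_path p m F (rcons s x) else F s.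

Section MeanPath.
Variables (R : realType) (T : finType) (p : T -> R).
Hypothesis p_dist : is_dist p.

(** The definition exposes the first draw; exposing the last one instead conditions on the past, as
    the one-step recursions below require. *)
Lemma mean_path_last n F s :
  mean_path p n.+1 F s = mean_path p n (fun t => \sum_x p x * F (rcons t x)) s.
Proof.
elim: n s => [//|n IHn] s.
by rewrite [LHS]/= [RHS]/=; apply: eq_bigr => x _; rewrite -IHn.
Qed.

(** Comparing only paths of the final length allows bounds that depend on time. *)
Lemma le_mean_path n F G s :
  (forall t, size t = (size s + n)%N -> F t <= G t) ->
  mean_path p n F s <= mean_path p n G s.
Proof.
elim: n s => [|n IHn] s FG /=; first by apply: FG; rewrite addn0.
apply: ler_sum => x _; apply: ler_wpM2l; first by case: p_dist.
by apply: IHn => t; rewrite size_rcons addSnnS; exact: FG.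
Qed.

Lemma eq_mean_path n F G s : F =1 G -> mean_path p n F s = mean_path p n G s.
Proof. by move=> /funext ->. Qed.

Lemma mean_pathD n F G s :
  mean_path p n (fun t => F t + G t) s = mean_path p n F s + mean_path p n G s.
Proof.
elim: n s => [//|n IHn] s /=.
by rewrite -big_split; apply: eq_bigr => x _; rewrite IHn mulrDr.
Qed.

Lemma mean_pathZ n c F s :
  mean_path p n (fun t => c * F t) s = c * mean_path p n F s.
Proof.
elim: n s => [//|n IHn] s /=.
by rewrite mulr_sumr; apply: eq_bigr => x _; rewrite IHn mulrCA.
Qed.

Lemma mean_path_cst n c s : mean_path p n (fun=> c) s = c.
Proof.
elim: n s => [//|n IHn] s /=.
under eq_bigr do rewrite IHn.
by rewrite -mulr_suml; case: p_dist => _ ->; rewrite mul1r.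
Qed.

Lemma mean_path_sum (I : finType) n (F : I -> seq T -> R) s :
  mean_path p n (fun t => \sum_i F i t) s = \sum_i mean_path p n (F i) s.
Proof.
elim: n s => [//|n IHn] s /=.
under eq_bigr do rewrite IHn mulr_sumr.
by rewrite exchange_big.
Qed.

End MeanPath.

(** * Expectations over the probability space as finite averages *)

Section Expectation.
Variables (R : realType) (disp : measure_display) (Omega : measurableType disp).
Variables (Pr : probability Omega R) (T : finType) (p : T -> R).
Variable X : nat -> Omega -> T.
Hypothesis mX : forall k (B : set T), measurable (X k @^-1` B).
Hypothesis pX : forall k x, Pr (X k @^-1` [set x]) = (p x)%:E.
Hypothesis indX : mutually_independent Pr X.

Let cylinder (s : seq T) : set Omega :=
  [set w | mkseq (X^~ w) (size s) = s].

Lemma cylinderE x0 s :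
  cylinder s =
  \big[setI/setT]_(k <- iota 0 (size s)) (X k @^-1` [set nth x0 s k]).
Proof.
rewrite -bigcap_seq; apply/seteqP; split=> w /=.
  by move=> sE k /=; rewrite mem_iota => ks; rewrite -[in RHS]sE nth_mkseq.
move=> sE; apply: (@eq_from_nth _ x0); rewrite size_mkseq// => k ks.
by rewrite nth_mkseq//; apply: sE; rewrite /= mem_iota.
Qed.

Lemma cylinder_rcons s x w :
  cylinder (rcons s x) w <-> cylinder s w /\ X (size s) w = x.
Proof.
rewrite /cylinder/= size_rcons mkseqS; split; last by case=> -> ->.
by move=> /rcons_inj[-> ->].
Qed.

Lemma measurable_cylinder s : measurable (cylinder s).
Proof.
(* [cylinderE] needs a default element for [nth], and [T] may be empty, so the empty path is treated
   apart. *)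
case: s => [|x s]; last first.
  rewrite (cylinderE x).
  by elim/big_ind : _ => // A B; exact: measurableI.
rewrite (_ : cylinder _ = setT)//.
by apply/seteqP; split.
Qed.

Lemma prob_cylinder s : Pr (cylinder s) = (\prod_(x <- s) p x)%:E.
Proof.
case: s => [|x0 s'].
  rewrite big_nil (_ : cylinder _ = setT) ?probability_setT//.
  by apply/seteqP; split.
rewrite (cylinderE x0) indX ?iota_uniq//.
rewrite (big_nth x0 xpredT p) -prodEFin /index_iota subn0.
by apply: eq_bigr => k _; rewrite pX.
Qed.

Lemma indic_cylinder s w :
  \1_(cylinder s) w = \sum_x \1_(cylinder (rcons s x)) w :> R.
Proof.
have E x : \1_(cylinder (rcons s x)) w =
    if x == X (size s) w then \1_(cylinder s) w else 0 :> R.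
  rewrite !indicE; case: eqP => [->|xX].
    by congr (_%:R); congr nat_of_bool; apply/idP/idP;
      rewrite !inE => ?; [apply: (iffLR (cylinder_rcons _ _ _) _).1|
      apply/cylinder_rcons]; eauto.
  rewrite memNset// => /cylinder_rcons[_ /esym]; exact: xX.
under eq_bigr do rewrite E.
by rewrite -big_mkcond big_pred1_eq.
Qed.

(** Induction on the number of unseen samples: the cylinder splits according to the next sample, and
    on a fully specified cylinder the integrand is constant. Measurability is proved alongside
    because exchanging integral and sum uses it. *)
Lemma integral_cylinder n (F : seq T -> R) s : (forall t, 0 <= F t) ->
  let f : Omega -> \bar R := fun w =>
    (\1_(cylinder s) w * F (mkseq (X^~ w) (size s + n)))%:E in
  measurable_fun setT f /\
  (\int[Pr]_w f w = Pr (cylinder s) * (mean_path p n F s)%:E)%E.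
Proof.
move=> F0; elim: n s => [|n IHn] s /=.
  rewrite (_ : (fun w => _) =
      fun w => ((F s)%:E * (\1_(cylinder s) w)%:E)%E); last first.
    apply/funext => w; rewrite addn0 -EFinM mulrC indicE.
    by case: (boolP (w \in cylinder s)); [rewrite inE => -> | rewrite !mulr0].
  have mI : measurable_fun setT (fun w => (\1_(cylinder s) w : R)%:E).
    apply/measurable_EFinP; apply: measurable_indic.
    exact: measurable_cylinder.
  split; first exact: measurable_funeM.
  rewrite ge0_integralZl//; last by rewrite lee_fin.
  by rewrite (integral_indic Pr _ (measurable_cylinder s))// setIT muleC.
rewrite (_ : (fun w => _) = fun w => (\sum_x
    (\1_(cylinder (rcons s x)) w *
       F (mkseq (X^~ w) (size (rcons s x) + n)))%:E)%E); last first.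
  apply/funext => w; rewrite indic_cylinder mulr_suml -sumEFin.
  by apply: eq_bigr => x _; rewrite size_rcons addSnnS.
split; first by apply: emeasurable_sum => x; apply: (IHn _).1.
rewrite ge0_integral_sum//; last 2 first.
- by move=> x; apply: (IHn _).1.
- by move=> x w _; rewrite lee_fin mulr_ge0// indicE.
rewrite -sumEFin ge0_sume_distrr; last first.
  move=> x _; rewrite lee_fin mulr_ge0//.
    by rewrite -lee_fin -(pX 0).
  elim: (n) (rcons s x) => [|m IHm] t //=; apply: sumr_ge0 => y _.
  by rewrite mulr_ge0// -lee_fin -(pX 0).
apply: eq_bigr => x _; rewrite (IHn _).2 !prob_cylinder -!EFinM.
by rewrite -cats1 big_cat big_seq1 /= mulrA.
Qed.

Lemma expectation_mean_path n (F : seq T -> R) : (forall t, 0 <= F t) ->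
  ('E_Pr[fun w => F (mkseq (X^~ w) n)] = (mean_path p n F [::])%:E)%E.
Proof.
move=> F0; rewrite unlock.
have [_] := integral_cylinder n [::] F0.
rewrite prob_cylinder big_nil mul1e add0n => <-.
apply: eq_integral => w _; rewrite indicE mem_set ?mul1r//.
Qed.

End Expectation.

(** * Maxima, soft maxima and accumulated noise *)

Lemma maxf_ge (R : realType) (T : finType) (f : T -> R) x : f x <= maxf f.
Proof. exact: (maxfP f x).2. Qed.

Lemma maxf_le (R : realType) (T : finType) (f : T -> R) (x0 : T) c :
  (forall x, f x <= c) -> maxf f <= c.
Proof. by have [[x ->] _] := maxfP f x0; apply. Qed.

(** Uncurried form of [norm_inf], convertible with it when [I] is [S * A]. *)
Definition supn (R : realType) (I : finType) (v : I -> R) : R :=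
  maxf (fun i => `|v i|).

Lemma le_supn (R : realType) (I : finType) (v : I -> R) i : `|v i| <= supn v.
Proof. exact: (maxf_ge (fun j => `|v j|)). Qed.

(** The sum of exponentials is at least its single term at [a]. *)
Lemma hLSE_ge (R : realType) (A : finType) (beta : R) (v : A -> R) a :
  0 < beta -> v a <= hLSE beta v.
Proof.
move=> b0; rewrite /hLSE -ler_pdivrMl ?invr_gt0// invrK.
rewrite -[leLHS]expRK ler_ln ?posrE ?expR_gt0//; last first.
  by rewrite (bigD1 a)//= ltr_pwDl ?expR_gt0// sumr_ge0// => *; exact: expR_ge0.
by rewrite (bigD1 a)//= lerDl sumr_ge0// => *; exact: expR_ge0.
Qed.

(** Each of the [#|A|] exponentials is at most the one at the maximum of [v]. *)
Lemma hLSE_le (R : realType) (A : finType) (beta : R) (v : A -> R) (a0 : A) :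
  0 < beta -> hLSE beta v <= maxf v + ln #|A|%:R / beta.
Proof.
move=> b0; have A0 : 0 < #|A|%:R :> R.
  by rewrite ltr0n; apply/card_gt0P; exists a0.
rewrite /hLSE -ler_pdivlMl ?invr_gt0// invrK.
rewrite mulrDr mulrCA mulfV ?gt_eqF// mulr1.
rewrite -[X in _ <= X + _]expRK addrC -lnM ?posrE ?expR_gt0//.
rewrite ler_ln ?posrE ?mulr_gt0 ?expR_gt0//; last first.
  by rewrite (bigD1 a0)//= ltr_pwDl ?expR_gt0// sumr_ge0// => *;
    exact: expR_ge0.
rewrite mulr_natl -sumr_const; apply: ler_sum => a _.
by rewrite ler_expR ler_pM2l// maxf_ge.
Qed.

(** * Second moments of a linear recursion driven by martingale noise *)

Section NoiseAccumulation.
Variables (R : realType) (T I : finType) (p : T -> R).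
Hypothesis p_dist : is_dist p.
Variables (M : I -> I -> R) (rho W K : R).
Variables (w : seq T -> T -> I -> R) (nu : seq T -> I -> R).
Hypothesis M_rho : forall i, \sum_j `|M i j| <= rho.
Hypothesis w_mean : forall s i, \sum_x p x * w s x i = 0.
Hypothesis w_var : forall s (c : I -> R),
  \sum_x p x * (\sum_i c i * w s x i) ^+ 2 <= W * (\sum_i `|c i|) ^+ 2.
Hypothesis nu0 : forall i, nu [::] i = 0.
Hypothesis nuS : forall s x i,
  nu (rcons s x) i = \sum_j M i j * nu s j + w s x i.
Hypothesis K_ge0 : 0 <= K.
(** [K] is a supersolution of the variance recursion, hence a bound uniform in time. *)
Hypothesis K_stable : rho ^+ 2 * K + W <= K.

(* Testing against every c replaces the covariance matrix: one step transports
   c to its image under the transpose of M, whose l1 norm is at most rho times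
   that of c. *)
Lemma mean_sqr_noise n (c : I -> R) :
  mean_path p n (fun s => (\sum_i c i * nu s i) ^+ 2) [::]
    <= K * (\sum_i `|c i|) ^+ 2.
Proof.
elim: n c => [|n IHn] c.
  rewrite /= big1 => [|i _]; last by rewrite nu0 mulr0.
  by rewrite expr0n/=; apply: mulr_ge0 (sqr_ge0 _).
rewrite mean_path_last; pose c' j := \sum_i c i * M i j.
have c'c : \sum_j `|c' j| <= rho * \sum_i `|c i|.
  apply: (@le_trans _ _ (\sum_j \sum_i `|c i| * `|M i j|)).
    apply: ler_sum => j _; apply: le_trans (ler_norm_sum _ _ _) _.
    by apply: ler_sum => i _; rewrite normrM.
  rewrite exchange_big mulr_sumr/=; apply: ler_sum => i _.
  by rewrite -mulr_sumr mulrC ler_wpM2r.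
have step s : \sum_x p x * (\sum_i c i * nu (rcons s x) i) ^+ 2
    <= (\sum_i c' i * nu s i) ^+ 2 + W * (\sum_i `|c i|) ^+ 2.
  set a := \sum_i c' i * nu s i.
  have split_a x : \sum_i c i * nu (rcons s x) i = a + \sum_i c i * w s x i.
    under eq_bigr do rewrite nuS mulrDr mulr_sumr.
    rewrite big_split/= exchange_big/=; congr (_ + _).
    apply: eq_bigr => j _; rewrite /c' mulr_suml; apply: eq_bigr => i _.
    by rewrite mulrA.
  (* Given the past, [a] is constant and [w] has mean zero, so the cross term of the square
     vanishes. *)
  clearbody a; have cross : \sum_x p x * (\sum_i c i * w s x i) = 0.
    under eq_bigr do rewrite mulr_sumr.
    rewrite exchange_big big1//= => i _.
    under eq_bigr do rewrite mulrCA.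
    by rewrite -mulr_sumr w_mean mulr0.
  rewrite (_ : \sum_x _ = a ^+ 2 * \sum_x p x +
     2 * a * (\sum_x p x * (\sum_i c i * w s x i)) +
     \sum_x p x * (\sum_i c i * w s x i) ^+ 2); last first.
    rewrite !mulr_sumr -!big_split/=; apply: eq_bigr => x _.
    by rewrite split_a; ring.
  by rewrite cross p_dist.2 mulr1 mulr0 addr0 lerD2l.
apply: le_trans (le_mean_path p_dist _) _ => [s _|]; first exact: step.
rewrite mean_pathD mean_path_cst//.
apply: le_trans (lerD (IHn c') (lexx _)) _.
apply: (@le_trans _ _ ((rho ^+ 2 * K + W) * (\sum_i `|c i|) ^+ 2)).
  rewrite mulrDl lerD2r (mulrC _ K) -mulrA ler_wpM2l// -exprMn.
  by rewrite lerXn2r// nnegrE ?(le_trans _ c'c)// sumr_ge0.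
by rewrite ler_wpM2r// sqr_ge0.
Qed.

(** In place of Jensen's inequality, [2 sigma |y| <= y^2 + sigma^2] linearises the norm; the largest
    square is bounded by the sum of all squares, each of mean at most [K]. *)
Lemma mean_supn_noise n (i0 : I) sigma :
  0 < sigma -> #|I|%:R * K <= sigma ^+ 2 ->
  mean_path p n (fun s => supn (nu s)) [::] <= sigma.
Proof.
move=> sigma0 Ksigma.
have amgm s : supn (nu s) <=
    (2 * sigma)^-1 * (\sum_i (nu s i) ^+ 2) + sigma / 2.
  apply: maxf_le => // i.
  have nui : (nu s i) ^+ 2 <= \sum_i (nu s i) ^+ 2.
    by rewrite (bigD1 i)//= lerDl sumr_ge0// => *; exact: sqr_ge0.
  rewrite -(ler_pM2l (mulr_gt0 (@ltr0n R 2) sigma0)) mulrDr mulrA.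
  rewrite mulfV ?mul1r; last lra.
  apply: le_trans (lerD nui (lexx _)).
  rewrite -[(nu s i) ^+ 2]ger0_norm ?sqr_ge0// normrX.
  have -> : 2 * sigma * (sigma / 2) = sigma ^+ 2 by field.
  have := sqr_ge0 (`|nu s i| - sigma); rewrite sqrrB; lra.
apply: le_trans (le_mean_path p_dist _) _ => [s _|]; first exact: amgm.
rewrite mean_pathD mean_path_cst// mean_pathZ mean_path_sum//.
have: \sum_i mean_path p n (fun s => nu s i ^+ 2) [::] <= sigma ^+ 2.
  apply: le_trans Ksigma; rewrite mulr_natl -sumr_const; apply: ler_sum => i _.
  (* A coordinate is tested by a unit vector, whose l1 norm is 1. *)
  have := mean_sqr_noise n (fun j => (j == i)%:R).
  have sum_delta (f : I -> R) : \sum_j (j == i)%:R * f j = f i.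
    rewrite (bigD1 i)//= eqxx mul1r big1 ?addr0// => j /negPf ->.
    by rewrite mul0r.
  rewrite [X in _ <= _ * X ^+ 2 -> _](_ : _ = 1); last first.
    rewrite -[RHS](sum_delta (fun=> 1)); apply: eq_bigr => j _.
    by rewrite mulr1 normr_nat.
  rewrite expr1n mulr1; apply: le_trans.
  rewrite le_eqVlt; apply/orP; left; apply/eqP.
  by apply: eq_mean_path => s; rewrite sum_delta.
move=> le_sum.
rewrite -[leRHS](_ : (2 * sigma)^-1 * sigma ^+ 2 + sigma / 2 = _).
  by rewrite lerD2r ler_wpM2l// invr_ge0; lra.
by field; lra.
Qed.

End NoiseAccumulation.

(** * The error decomposition of LSE soft Q-learning *)

Section LSE.
Variables (R : realType) (S A : finType).
Variables (P : S -> A -> S -> R) (r : S -> A -> S -> R) (d : S -> A -> R).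
Variables (gamma alpha beta : R) (Q0 Qstar : S -> A -> R).
Hypothesis P_transition : is_transition P.
Hypothesis r_bounded : forall s a s', `|r s a s'| <= 1.
Hypothesis d_dist : is_dist (fun p : S * A => d p.1 p.2).
Hypothesis d_gt0 : forall s a, 0 < d s a.
Hypotheses (gamma_ge0 : 0 <= gamma) (gamma_lt1 : gamma < 1).
Hypotheses (alpha_gt0 : 0 < alpha) (alpha_lt1 : alpha < 1).
Hypothesis beta_gt0 : 0 < beta.
Hypothesis Q0_bounded : norm_inf Q0 <= 1.
Hypothesis Qstar_optimal : is_optimal_Q P r gamma Qstar.
Variable p0 : S * A.
Variable greedy : S -> A.
Hypothesis greedyP : forall s, maxf (Qstar s) = Qstar s (greedy s).

Let dmax := maxf (fun p : S * A => d p.1 p.2).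
Let dmin := minf (fun p : S * A => d p.1 p.2).
Let rho := 1 - alpha * dmin * (1 - gamma).
Let L := ln #|A|%:R / beta.
(** The solution of [B = 1 + L + gamma * B]: reward bound, soft-maximum excess and discounted
    bound. *)
Let B := (1 + L) / (1 - gamma).

Definition sample_weight (x : S * A * S) : R :=
  d x.1.1 x.1.2 * P x.1.1 x.1.2 x.2.

Definition td_error (Q : S -> A -> R) (x : S * A * S) (p : S * A) : R :=
  if p == x.1 then
    r x.1.1 x.1.2 x.2 + gamma * hLSE beta (Q x.2) - Q p.1 p.2
  else 0.

Definition mean_td_error (Q : S -> A -> R) (p : S * A) : R :=
  \sum_x sample_weight x * td_error Q x p.

(* The system matrix I - alpha D + alpha gamma D P Pi of the paper, where Pi
   selects the greedy action of Qstar. *)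
Definition greedy_mx (p j : S * A) : R :=
  (1 - alpha * d p.1 p.2) * (p == j)%:R
  + alpha * gamma * d p.1 p.2 * P p.1 p.2 j.1 * (j.2 == greedy j.1)%:R.

Definition greedy_step (v : S * A -> R) (p : S * A) : R :=
  \sum_j greedy_mx p j * v j.

Definition drift (k : nat) : S * A -> R :=
  iter k greedy_step (fun p => Q0 p.1 p.2 - Qstar p.1 p.2).

Let step := lse_step r gamma alpha beta.

Definition lse_path (s : seq (S * A * S)) : S -> A -> R := foldl step Q0 s.

Definition noise_input (s : seq (S * A * S)) (x : S * A * S) (p : S * A) : R :=
  alpha * (td_error (lse_path s) x p - mean_td_error (lse_path s) p).

(** The noise input depends on the current iterate, so iterate and noise are folded together as one
    state. *)
Definition lse_noise_step
    (u : (S -> A -> R) * (S * A -> R)) (x : S * A * S) :=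
  (step u.1 x, fun p => greedy_step u.2 p
     + alpha * (td_error u.1 x p - mean_td_error u.1 p)).

Definition noise (s : seq (S * A * S)) : S * A -> R :=
  (foldl lse_noise_step (Q0, fun=> 0) s).2.

(* What remains of Q_k - Qstar after subtracting the lower linear comparison
   system started at Q_0 - Qstar. *)
Definition residual (s : seq (S * A * S)) (p : S * A) : R :=
  lse_path s p.1 p.2 - Qstar p.1 p.2 - drift (size s) p - noise s p.

(** * Recursions along a sample path and the mean update *)

Lemma lse_pathE f k : lse_Q r gamma alpha beta Q0 f k = lse_path (mkseq f k).
Proof.
by elim: k => [//|k IHk] /=; rewrite mkseqS /lse_path foldl_rcons IHk.
Qed.

Lemma lse_path_rcons s x p :
  lse_path (rcons s x) p.1 p.2 =
  lse_path s p.1 p.2 + alpha * td_error (lse_path s) x p.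
Proof.
rewrite /lse_path foldl_rcons /step /lse_step /td_error.
case: x p => [[sk ak] sk'] [s' a'] /=; rewrite xpair_eqE.
by case: ifP => [/andP[/eqP -> /eqP ->]//|_]; rewrite mulr0 addr0.
Qed.

Lemma lse_noise_path s : (foldl lse_noise_step (Q0, fun=> 0) s).1 = lse_path s.
Proof.
by elim/last_ind: s => [//|s y IHs]; rewrite /lse_path !foldl_rcons /= IHs.
Qed.

Lemma noise_rcons s x p :
  noise (rcons s x) p = greedy_step (noise s) p + noise_input s x p.
Proof. by rewrite /noise foldl_rcons /= lse_noise_path. Qed.

Lemma sample_weight_dist : is_dist sample_weight.
Proof.
split=> [x|].
  by rewrite mulr_ge0 ?(ltW (d_gt0 _ _))// (P_transition _ _).1.
rewrite -(pair_bigA _ (fun i s' => sample_weight (i, s')))/=.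
rewrite -d_dist.2; apply: eq_bigr => i _.
by rewrite /sample_weight/= -mulr_sumr (P_transition _ _).2 mulr1.
Qed.

Lemma sum_P_cst (p : S * A) c : \sum_s' P p.1 p.2 s' * c = c.
Proof. by rewrite -mulr_suml (P_transition _ _).2 mul1r. Qed.

Lemma mean_td_errorE Q p :
  mean_td_error Q p = d p.1 p.2 *
    (\sum_s' P p.1 p.2 s' * (r p.1 p.2 s' + gamma * hLSE beta (Q s'))
     - Q p.1 p.2).
Proof.
rewrite /mean_td_error.
rewrite -(pair_bigA _ (fun i s' =>
  sample_weight (i, s') * td_error Q (i, s') p))/=.
rewrite (bigD1 p)//= [X in _ + X]big1 ?addr0; last first.
  move=> i ip; apply: big1 => s' _.
  by rewrite /td_error /= eq_sym (negPf ip) mulr0.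
rewrite -[X in _ * (_ - X)](sum_P_cst p) -sumrB mulr_sumr.
by apply: eq_bigr => s' _; rewrite /td_error eqxx /sample_weight /=; ring.
Qed.

Lemma greedy_stepE v p :
  greedy_step v p = (1 - alpha * d p.1 p.2) * v p
    + alpha * gamma * d p.1 p.2 * \sum_s' P p.1 p.2 s' * v (s', greedy s').
Proof.
rewrite /greedy_step.
under eq_bigr do rewrite mulrDl.
rewrite big_split/=; congr (_ + _).
  rewrite (bigD1 p)//= eqxx mulr1 big1 ?addr0// => j jp.
  by rewrite eq_sym (negPf jp) mulr0 mul0r.
rewrite mulr_sumr.
under eq_bigr => j _ do rewrite [X in v X]surjective_pairing.
rewrite -(pair_bigA _ (fun s' a' => alpha * gamma * d p.1 p.2 * P p.1 p.2 s' *
  (a' == greedy s')%:R * v (s', a')))/=.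
apply: eq_bigr => s' _; rewrite (bigD1 (greedy s'))//= eqxx mulr1 big1 ?addr0.
  by rewrite mulrA.
by move=> a' /negPf ->; rewrite mulr0 mul0r.
Qed.

(** * Bounds on the constants, the iterates and the drift *)

Lemma d_le1 (p : S * A) : d p.1 p.2 <= 1.
Proof.
rewrite -d_dist.2 (bigD1 p)//= lerDl sumr_ge0// => i _; exact: ltW.
Qed.

Lemma dmax_ge (p : S * A) : d p.1 p.2 <= dmax.
Proof. exact: (maxf_ge (fun p => d p.1 p.2)). Qed.

Lemma dmin_le (p : S * A) : dmin <= d p.1 p.2.
Proof. exact: (minfP (fun p => d p.1 p.2) p0).2. Qed.

Lemma dmin_gt0 : 0 < dmin.
Proof. by rewrite /dmin; have [[p ->] _] := minfP (fun p => d p.1 p.2) p0. Qed.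

Lemma dmax_gt0 : 0 < dmax.
Proof. exact: lt_le_trans (d_gt0 p0.1 p0.2) (dmax_ge p0). Qed.

Lemma dmax_le1 : dmax <= 1.
Proof. by apply: maxf_le => // p; exact: d_le1. Qed.

Lemma alpha_d_le1 (p : S * A) : alpha * d p.1 p.2 <= 1.
Proof. by rewrite mulr_ile1// ?d_le1// ltW. Qed.

Lemma contraction_le_rho (p : S * A) :
  1 - alpha * d p.1 p.2 + alpha * gamma * d p.1 p.2 <= rho.
Proof.
have : alpha * (1 - gamma) * dmin <= alpha * (1 - gamma) * d p.1 p.2.
  by rewrite ler_wpM2l ?dmin_le// mulr_ge0 ?subr_ge0// ltW.
rewrite /rho; lra.
Qed.

Lemma rho_gt0 : 0 < rho.
Proof.
rewrite /rho subr_gt0; apply: le_lt_trans alpha_lt1.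
have a1 : alpha * dmin <= alpha.
  by rewrite ger_pMr// (le_trans (dmin_le p0))// d_le1.
by apply: le_trans a1; rewrite ger_pMr ?mulr_gt0 ?dmin_gt0// gerBl.
Qed.

Lemma L_ge0 : 0 <= L.
Proof.
rewrite divr_ge0 ?ln_ge0 ?(ltW beta_gt0)// ler1n.
by apply/card_gt0P; exists p0.2.
Qed.

Lemma B_ge : (1 - gamma)^-1 <= B /\ 1 <= B.
Proof.
have g1 : 0 < 1 - gamma by rewrite subr_gt0.
have L0 := L_ge0.
have H : (1 - gamma)^-1 <= B.
  by rewrite /B -[leLHS]mul1r ler_wpM2r ?invr_ge0 ?(ltW g1)// lerDl.
by split=> //; apply: le_trans H; rewrite invf_ge1// gerBl.
Qed.

Lemma B_eq : B * (1 - gamma) = 1 + L.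
Proof. by rewrite /B -mulrA mulVf ?mulr1// subr_eq0 gt_eqF. Qed.

Lemma hLSE_bounded (v : A -> R) : (forall a, `|v a| <= B) ->
  - B <= hLSE beta v <= B + L.
Proof.
move=> vB; apply/andP; split.
  apply: le_trans (hLSE_ge v p0.2 beta_gt0).
  by have := vB p0.2; rewrite ler_norml => /andP[].
apply: le_trans (hLSE_le v p0.2 beta_gt0) _; rewrite lerD2r.
by apply: maxf_le => [|a]; [exact: p0.2|apply: le_trans (ler_norm _) (vB a)].
Qed.

Lemma lse_target_bounded s a s' (v : A -> R) : (forall a, `|v a| <= B) ->
  `|r s a s' + gamma * hLSE beta v| <= B.
Proof.
move=> /hLSE_bounded/andP[h1 h2].
have := r_bounded s a s'; rewrite !ler_norml => /andP[r1 r2].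
have := B_eq; have := B_ge.2; have := L_ge0.
have := ler_wpM2l gamma_ge0 h1; have := ler_wpM2l gamma_ge0 h2.
move: (hLSE _ _) => h *; apply/andP; split; first nra.
(* This is [gamma * L <= L], which brings [1 + gamma * (B + L)] below [B]. *)
have : 0 <= L * (1 - gamma) by rewrite mulr_ge0// subr_ge0 ltW.
nra.
Qed.

(** An updated entry is a convex combination of its old value and a target, both bounded by [B]. *)
Lemma lse_path_bounded s p : `|lse_path s p.1 p.2| <= B.
Proof.
elim/last_ind: s p => [|s x IHs] p.
  apply: le_trans (B_ge.2); apply: le_trans Q0_bounded.
  exact: (le_supn (fun p => Q0 p.1 p.2) p).
rewrite lse_path_rcons /td_error; case: eqP => [->|_]; last first.
  by rewrite mulr0 addr0.
have := lse_target_bounded x.1.1 x.1.2 x.2 (fun a => IHs (x.2, a)).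
have := IHs x.1; move: (_ + gamma * _) => y /=.
move: (lse_path s _ _) => q qB yB.
rewrite (_ : _ + _ = (1 - alpha) * q + alpha * y); last by ring.
apply: le_trans (ler_normD _ _) _; rewrite !normrM (gtr0_norm alpha_gt0).
have a1 : 0 <= 1 - alpha by rewrite subr_ge0 ltW.
rewrite (ger0_norm a1).
apply: le_trans (lerD (ler_wpM2l a1 qB) (ler_wpM2l (ltW alpha_gt0) yB)) _.
by rewrite -mulrDl subrK mul1r.
Qed.

Lemma td_error_bounded s x p : `|td_error (lse_path s) x p| <= 2 * B.
Proof.
rewrite /td_error; case: eqP => [_|_]; last first.
  by rewrite normr0; have := B_ge.2; lra.
apply: le_trans (ler_normB _ _) _.
have := lse_target_bounded x.1.1 x.1.2 x.2
  (fun a => lse_path_bounded s (x.2, a)).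
by have := lse_path_bounded s p => /=; lra.
Qed.

(** The Bellman equation gives [N <= 1 + gamma * N] for the norm [N] of [Qstar]. *)
Lemma Qstar_bounded p : `|Qstar p.1 p.2| <= (1 - gamma)^-1.
Proof.
have g1 : 0 < 1 - gamma by rewrite subr_gt0.
pose N := norm_inf Qstar.
have QN q : `|Qstar q.1 q.2| <= N.
  exact: (le_supn (fun p => Qstar p.1 p.2) q).
have H q : `|Qstar q.1 q.2| <= 1 + gamma * N.
  rewrite Qstar_optimal; apply: le_trans (ler_norm_sum _ _ _) _.
  rewrite -[leRHS](sum_P_cst q); apply: ler_sum => s' _.
  have P0 : 0 <= P q.1 q.2 s' := (P_transition _ _).1 _.
  rewrite normrM (ger0_norm P0) ler_wpM2l//.
  apply: le_trans (ler_normD _ _) _; apply: lerD => //.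
  rewrite normrM (ger0_norm gamma_ge0) ler_wpM2l// greedyP.
  exact: (QN (s', _)).
have NN : N <= 1 + gamma * N by apply: maxf_le.
apply: le_trans (QN p) _; rewrite -[leRHS]mul1r ler_pdivlMr//; lra.
Qed.

(** The entries are nonnegative, so the row sum is the image of the constant vector 1. *)
Lemma greedy_mx_row p : \sum_j `|greedy_mx p j| <= rho.
Proof.
apply: le_trans (contraction_le_rho p).
rewrite (_ : \sum_j _ = greedy_step (fun=> 1) p).
  by rewrite greedy_stepE sum_P_cst !mulr1.
apply: eq_bigr => j _; rewrite mulr1 ger0_norm//.
have [a0 dp0] := (ltW alpha_gt0, ltW (d_gt0 p.1 p.2)).
have Pp0 : 0 <= P p.1 p.2 j.1 := (P_transition _ _).1 _.
by rewrite /greedy_mx addr_ge0 ?mulr_ge0 ?subr_ge0 ?alpha_d_le1.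
Qed.

Lemma drift_bounded k p : `|drift k p| <= rho ^+ k * (2 / (1 - gamma)).
Proof.
elim: k p => [|k IHk] p; last first.
  rewrite /drift iterS -/(drift k) /greedy_step.
  apply: le_trans (ler_norm_sum _ _ _) _; rewrite exprS -mulrA.
  apply: (@le_trans _ _
      (\sum_j `|greedy_mx p j| * (rho ^+ k * (2 / (1 - gamma))))).
    by apply: ler_sum => j _; rewrite normrM ler_wpM2l.
  rewrite -mulr_suml ler_wpM2r ?greedy_mx_row//.
  exact: le_trans (normr_ge0 _) (IHk p).
rewrite expr0 mul1r /drift/=; apply: le_trans (ler_normB _ _) _.
have Q0p : `|Q0 p.1 p.2| <= (1 - gamma)^-1.
  apply: le_trans (le_supn (fun p => Q0 p.1 p.2) p) _.
  by apply: le_trans Q0_bounded _; rewrite invf_ge1 ?subr_gt0// gerBl.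
by rewrite mulr_natl mulr2n lerD// Qstar_bounded.
Qed.

(** * The residual: recursion, sign and growth *)

Lemma lse_pathE_residual s p :
  lse_path s p.1 p.2 =
  Qstar p.1 p.2 + drift (size s) p + noise s p + residual s p.
Proof. by rewrite /residual; ring. Qed.

Lemma greedy_step_add u v p :
  greedy_step (fun j => u j + v j) p = greedy_step u p + greedy_step v p.
Proof.
by rewrite /greedy_step -big_split; apply: eq_bigr => j _; rewrite mulrDr.
Qed.

(* The noise cancels, so the residual obeys a recursion driven only by the
   gap between the soft maximum and the greedy action of Qstar. *)
Lemma residual_rcons s x p :
  residual (rcons s x) p = (1 - alpha * d p.1 p.2) * residual s p
  + alpha * gamma * d p.1 p.2 * \sum_s' P p.1 p.2 s' *
     (hLSE beta (lse_path s s') - maxf (Qstar s')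
      - (drift (size s) (s', greedy s') + noise s (s', greedy s'))).
Proof.
rewrite [in LHS]/residual lse_path_rcons noise_rcons /noise_input size_rcons.
have -> : drift (size s).+1 p = greedy_step (drift (size s)) p.
  by rewrite /drift iterS.
rewrite mean_td_errorE.
transitivity (lse_path s p.1 p.2 - Qstar p.1 p.2
   - greedy_step (fun j => drift (size s) j + noise s j) p
   + alpha * d p.1 p.2 *
    ((\sum_s' P p.1 p.2 s' * (r p.1 p.2 s' + gamma * hLSE beta (lse_path s s')))
      - Qstar p.1 p.2 - (lse_path s p.1 p.2 - Qstar p.1 p.2))).
  by rewrite greedy_step_add; ring.
(* Expanding [Qstar] by the Bellman equation cancels the rewards and leaves only differences of
   [hLSE] and [maxf]. *)
rewrite [X in _ - X - (_ - _)]Qstar_optimal -sumrB.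
rewrite (eq_bigr (fun s' => gamma *
  (P p.1 p.2 s' * (hLSE beta (lse_path s s') - maxf (Qstar s'))))); last first.
  by move=> s' _; ring.
rewrite -mulr_sumr greedy_stepE [in RHS](eq_bigr (fun s' =>
   P p.1 p.2 s' * (hLSE beta (lse_path s s') - maxf (Qstar s')) -
   P p.1 p.2 s' * (drift (size s) (s', greedy s') + noise s (s', greedy s'))));
  last by move=> s' _; rewrite mulrBr.
by rewrite sumrB /residual; ring.
Qed.

(** By induction: the soft maximum is at least the iterate at the greedy action, so the driving gap
    is at least the previous residual there. *)
Lemma residual_ge0 s p : 0 <= residual s p.
Proof.
elim/last_ind: s p => [|s x IHs] p.
  by rewrite /residual /noise /drift /= subr0 subrr.
have [a0 dp0] := (ltW alpha_gt0, ltW (d_gt0 p.1 p.2)).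
have ap : 0 <= 1 - alpha * d p.1 p.2 by rewrite subr_ge0 alpha_d_le1.
rewrite residual_rcons; apply: addr_ge0; apply: mulr_ge0 => //.
  by rewrite !mulr_ge0.
apply: sumr_ge0 => s' _; rewrite mulr_ge0//; first exact: (P_transition _ _).1.
have := hLSE_ge (lse_path s s') (greedy s') beta_gt0.
rewrite (lse_pathE_residual s (s', greedy s')) greedyP /=.
have := IHs (s', greedy s'); lra.
Qed.

(** The gap contributes one copy of the residual norm; together with the diagonal term its
    coefficient is at most [rho]. *)
Lemma residual_step s x :
  supn (residual (rcons s x)) <= rho * supn (residual s)
    + alpha * gamma * dmax *
        (L + 2 * (supn (drift (size s)) + supn (noise s))).
Proof.
set Y := supn (drift _) + _; set Z := supn (residual s).
have Y0 : 0 <= Y.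
  rewrite /Y addr_ge0//; apply: le_trans (normr_ge0 _) (le_supn _ p0).
have Z0 : 0 <= Z by exact: le_trans (normr_ge0 _) (le_supn _ p0).
have yY j : `|drift (size s) j + noise s j| <= Y.
  by apply: le_trans (ler_normD _ _) _; rewrite lerD// le_supn.
have zZ j : residual s j <= Z.
  by apply: le_trans (ler_norm _) _; exact: le_supn.
(* [Y] is paid twice: once at the action maximising the iterate, once at the greedy action. *)
have gap s' : hLSE beta (lse_path s s') - maxf (Qstar s')
    - (drift (size s) (s', greedy s') + noise s (s', greedy s'))
    <= L + Z + 2 * Y.
  have lsemax : maxf (lse_path s s') <= maxf (Qstar s') + Y + Z.
    apply: maxf_le => [|a]; first exact: p0.2.
    rewrite (lse_pathE_residual s (s', a)) /=.
    have := maxf_ge (Qstar s') a; have := zZ (s', a).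
    have := le_trans (ler_norm _) (yY (s', a)); lra.
  have := hLSE_le (lse_path s s') p0.2 beta_gt0; rewrite -/L.
  have := yY (s', greedy s'); rewrite ler_norml => /andP[+ _]; lra.
apply: maxf_le => // p; rewrite ger0_norm ?residual_ge0// residual_rcons.
have dp0 : 0 <= alpha * gamma * d p.1 p.2.
  by rewrite !mulr_ge0// ltW.
have ap : 0 <= 1 - alpha * d p.1 p.2 by rewrite subr_ge0 alpha_d_le1.
apply: (@le_trans _ _ ((1 - alpha * d p.1 p.2) * Z
   + alpha * gamma * d p.1 p.2 * (L + Z + 2 * Y))).
  apply: lerD; apply: ler_wpM2l => //.
  rewrite -[leRHS](sum_P_cst p); apply: ler_sum => s' _.
  by rewrite ler_wpM2l// (P_transition _ _).1.
rewrite (_ : _ + _ = (1 - alpha * d p.1 p.2 + alpha * gamma * d p.1 p.2) * Z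
  + alpha * gamma * d p.1 p.2 * (L + 2 * Y)); last by ring.
apply: lerD; first by rewrite ler_wpM2r// contraction_le_rho.
apply: ler_wpM2r; first by apply: addr_ge0; [exact: L_ge0|rewrite mulr_ge0].
by rewrite ler_wpM2l ?dmax_ge// mulr_ge0// ltW.
Qed.

(** * Moments of the noise and the mean error *)

Lemma sum_weight_cst c : \sum_x sample_weight x * c = c.
Proof. by rewrite -mulr_suml sample_weight_dist.2 mul1r. Qed.

Lemma noise_input_mean s p : \sum_x sample_weight x * noise_input s x p = 0.
Proof.
rewrite /noise_input.
under eq_bigr do rewrite mulrCA mulrBr.
rewrite -mulr_sumr sumrB sum_weight_cst.
by rewrite /mean_td_error subrr mulr0.
Qed.

(** A variance is at most the second moment, and the tested error is at most [2 * B] times the l1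
    norm of [c]. *)
Lemma noise_input_var s (c : S * A -> R) :
  \sum_x sample_weight x * (\sum_p c p * noise_input s x p) ^+ 2
    <= alpha ^+ 2 * (2 * B) ^+ 2 * (\sum_p `|c p|) ^+ 2.
Proof.
pose Y x := \sum_p c p * td_error (lse_path s) x p.
pose m := \sum_x sample_weight x * Y x.
have cY x : \sum_p c p * noise_input s x p = alpha * (Y x - m).
  have -> : m = \sum_p c p * mean_td_error (lse_path s) p.
    rewrite /m /Y; under eq_bigr do rewrite mulr_sumr.
    rewrite exchange_big; apply: eq_bigr => p _.
    rewrite /mean_td_error mulr_sumr.
    by apply: eq_bigr => y _; rewrite mulrCA.
  rewrite /Y -sumrB mulr_sumr; apply: eq_bigr => p _.
  by rewrite /noise_input; ring.
under eq_bigr do rewrite cY exprMn mulrCA.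
rewrite -mulr_sumr -mulrA ler_wpM2l ?sqr_ge0//.
apply: (@le_trans _ _ (\sum_x sample_weight x * Y x ^+ 2)).
  rewrite [leLHS](_ : _ = \sum_x sample_weight x * Y x ^+ 2 - m ^+ 2).
    by rewrite gerBl sqr_ge0.
  transitivity (\sum_x sample_weight x * Y x ^+ 2 - 2 * m * m
    + m ^+ 2 * \sum_x sample_weight x); last first.
    by rewrite sample_weight_dist.2; ring.
  have -> : 2 * m * m = \sum_x 2 * m * (sample_weight x * Y x).
    by rewrite -mulr_sumr.
  rewrite [m ^+ 2 * _]mulr_sumr -sumrB -big_split.
  by apply: eq_bigr => x _ /=; ring.
rewrite -[leRHS]sum_weight_cst; apply: ler_sum => x _.
rewrite ler_wpM2l ?sample_weight_dist.1// -exprMn.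
rewrite -[Y x ^+ 2]ger0_norm ?sqr_ge0//.
rewrite normrX lerXn2r ?nnegrE//.
  apply: mulr_ge0; last exact: sumr_ge0.
  by apply: mulr_ge0 => //; exact: le_trans ler01 B_ge.2.
apply: le_trans (ler_norm_sum _ _ _) _; rewrite mulr_sumr.
by apply: ler_sum => p _; rewrite normrM mulrC ler_wpM2r// td_error_bounded.
Qed.

(** Chosen so that [(1 - rho) * K] is the one-step variance bound [alpha ^+ 2 * (2 * B) ^+ 2]. *)
Let K := alpha * (2 * B) ^+ 2 / (dmin * (1 - gamma)).

Lemma mean_noise n sigma : 0 < sigma -> #|{: S * A}|%:R * K <= sigma ^+ 2 ->
  mean_path sample_weight n (fun s => supn (noise s)) [::] <= sigma.
Proof.
have dm := dmin_gt0; have g1 : 0 < 1 - gamma by rewrite subr_gt0.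
have K0 : 0 <= K.
  apply: divr_ge0; first by apply: mulr_ge0 (sqr_ge0 _); exact: ltW.
  by apply: mulr_ge0; exact: ltW.
apply: (@mean_supn_noise _ _ _ _ sample_weight_dist greedy_mx rho
  (alpha ^+ 2 * (2 * B) ^+ 2) K noise_input noise greedy_mx_row
  noise_input_mean noise_input_var _ noise_rcons K0) => //.
have -> : alpha ^+ 2 * (2 * B) ^+ 2 = (1 - rho) * K.
  by rewrite /rho /K; field; rewrite !gt_eqF.
(* With this [K], the stability condition is exactly this inequality. *)
have : 0 <= rho * (1 - rho) * K.
  apply: mulr_ge0 => //; apply: mulr_ge0; first exact: ltW rho_gt0.
  rewrite /rho opprB addrCA subrr addr0.
  by rewrite !mulr_ge0// ltW.
lra.
Qed.

(** Solves the scalar recursion: the constant input sums to a geometric series, while the drift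
    input decays at the same rate [rho] as the recursion and so produces [n * rho ^ (n - 1)]. *)
Lemma mean_residual n sigma :
  (forall k,
     mean_path sample_weight k (fun s => supn (noise s)) [::] <= sigma) ->
  mean_path sample_weight n (fun s => supn (residual s)) [::] <=
    alpha * gamma * dmax * (L + 2 * sigma) / (1 - rho)
    + 4 * alpha * gamma * dmax / (1 - gamma) * (n%:R * rho ^+ n.-1).
Proof.
move=> noise_le; set b := alpha * gamma * dmax.
have b0 : 0 <= b by rewrite !mulr_ge0// ltW// dmax_gt0.
have g1 : 0 < 1 - gamma by rewrite subr_gt0.
have rho1 : 0 < 1 - rho.
  by rewrite /rho opprB addrCA subrr addr0 !mulr_gt0// dmin_gt0.
have L0 := L_ge0.
have sigma0 : 0 <= sigma.
  apply: le_trans (noise_le 0%N) => /=.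
  exact: le_trans (normr_ge0 _) (le_supn _ p0).
elim: n => [|n IHn].
  rewrite mul0r mulr0 addr0 /=.
  apply: (@le_trans _ _ 0); last first.
    apply: divr_ge0 (ltW rho1); apply: mulr_ge0 => //.
    by apply: addr_ge0 => //; exact: mulr_ge0.
  apply: maxf_le => // p.
  by rewrite /residual /noise /drift /= subr0 subrr normr0.
rewrite mean_path_last.
pose F s := rho * supn (residual s) +
  (b * (L + 2 * (rho ^+ n * (2 / (1 - gamma)))) + b * 2 * supn (noise s)).
apply: (@le_trans _ _ (mean_path sample_weight n F [::])).
  apply: (le_mean_path sample_weight_dist) => s; rewrite /= add0n => sn.
  rewrite -[leRHS]sum_weight_cst; apply: ler_sum => x _.
  rewrite ler_wpM2l ?sample_weight_dist.1//.
  apply: le_trans (residual_step s x) _; rewrite /F lerD2l -/b.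
  have : supn (drift (size s)) <= rho ^+ n * (2 / (1 - gamma)).
    by apply: maxf_le => // p; rewrite -sn drift_bounded.
  move=> /(ler_wpM2l b0); lra.
rewrite /F !mean_pathD !mean_pathZ mean_path_cst; last first.
  exact: sample_weight_dist.
have := ler_wpM2l (ltW rho_gt0) IHn.
have := ler_wpM2l (mulr_ge0 b0 (ler0n R 2)) (noise_le n).
(* For [n = 0] the truncated exponent [n.-1] is harmless, since the factor [n] vanishes. *)
have -> : n.+1%:R * rho ^+ n.+1.-1 = rho * (n%:R * rho ^+ n.-1) + rho ^+ n :> R.
  case: n {IHn F} => [|n] /=; first by rewrite !expr0; ring.
  by rewrite exprS -(natr1 n.+1); ring.
(* The constant part is the fixed point of the recursion with input [b * (L + 2 * sigma)]. *)
have : b * (L + 2 * sigma) / (1 - rho) * (1 - rho) = b * (L + 2 * sigma).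
  by rewrite mulfVK// gt_eqF.
move: (b * (L + 2 * sigma) / (1 - rho)) => C CE.
move: (mean_path _ _ _ _) => m1; move: (mean_path _ _ _ _) => m2 h1 h2.
apply: le_trans (lerD h2 (lerD (lexx _) h1)) _.
rewrite -/b (_ : 4 * alpha * gamma * dmax = 4 * b); last by rewrite /b; ring.
lra.
Qed.

Lemma mean_error n sigma : 0 < sigma -> #|{: S * A}|%:R * K <= sigma ^+ 2 ->
  mean_path sample_weight n
    (fun s => norm_inf (fun s' a => lse_path s s' a - Qstar s' a)) [::] <=
  sigma + alpha * gamma * dmax * (L + 2 * sigma) / (1 - rho)
    + 4 * alpha * gamma * dmax / (1 - gamma) * (n%:R * rho ^+ n.-1)
    + 2 / (1 - gamma) * rho ^+ n.
Proof.
move=> sigma0 Ksigma; have noise_le k := mean_noise k sigma0 Ksigma.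
apply: (@le_trans _ _ (mean_path sample_weight n (fun s =>
  supn (noise s) + (supn (residual s) + 2 / (1 - gamma) * rho ^+ n)) [::])).
  apply: (le_mean_path sample_weight_dist) => s; rewrite /= add0n => sn.
  apply: maxf_le => // p.
  rewrite lse_pathE_residual (_ : _ - _ =
    noise s p + (residual s p + drift (size s) p)); last by ring.
  apply: le_trans (ler_normD _ _) _; rewrite lerD ?le_supn//.
  apply: le_trans (ler_normD _ _) _; rewrite lerD ?le_supn//.
  by rewrite mulrC -sn drift_bounded.
rewrite !mean_pathD mean_path_cst; last exact: sample_weight_dist.
rewrite addrA lerD2r -addrA; apply: lerD; first exact: noise_le.
exact: mean_residual.
Qed.

End LSE.

(** * Half-integer powers and assembly of the final bound *)

Lemma powR_half_odd (R : realType) (x : R) n : 0 < x ->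
  x `^ (n.*2.+1%:R / 2) = x ^+ n * Num.sqrt x.
Proof.
move=> x0; rewrite -powR12_sqrt ?ltW// -powR_mulrn ?ltW// -powRD; last first.
  by rewrite (gt_eqF x0) implybT.
by congr (_ `^ _); rewrite -natr1 -muln2 natrM; field.
Qed.

Theorem theorem4p2 (R : realType) (S A : finType)
    (P : S -> A -> S -> R) (r : S -> A -> S -> R) (d : S -> A -> R)
    (gamma alpha beta : R) (Q0 Qstar : S -> A -> R)
    (disp : measure_display) (Omega : measurableType disp)
    (Pr : probability Omega R) (X : nat -> Omega -> S * A * S)
    (P_transition : is_transition P)
    (r_bounded : forall s a s', `|r s a s'| <= 1)
    (d_dist : is_dist (fun p : S * A => d p.1 p.2))
    (d_gt0 : forall s a, 0 < d s a)
    (gamma_ge0 : 0 <= gamma) (gamma_lt1 : gamma < 1)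
    (alpha_gt0 : 0 < alpha) (alpha_lt1 : alpha < 1)
    (beta_gt0 : 0 < beta)
    (Q0_bounded : norm_inf Q0 <= 1)
    (Qstar_optimal : is_optimal_Q P r gamma Qstar)
    (X_iid : iid_sampling Pr d P X) :
  let dmax : R := maxf (fun p : S * A => d p.1 p.2) in
  let dmin : R := minf (fun p : S * A => d p.1 p.2) in
  let rho : R := 1 - alpha * dmin * (1 - gamma) in
  let nA : R := #|A|%:R in
  let nSA : R := #|{: S * A}|%:R in
  forall k : nat,
    ('E_Pr[fun w => norm_inf (fun s a =>
        lse_Q r gamma alpha beta Q0 (fun j => X j w) k s a - Qstar s a)%R]
     <= (3 * Num.sqrt 6 * alpha `^ (1 / 2) * dmax * (ln nA + beta) * nSA
           / (beta * dmin `^ (3 / 2) * (1 - gamma) `^ (5 / 2))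
         + 4 * alpha * gamma * dmax * nSA `^ (3 / 2) / (1 - gamma)
           * (k%:R * rho ^ (k%:Z - 1))
         + ln nA / (beta * dmin * (1 - gamma))
         + 2 * nSA `^ (3 / 2) / (1 - gamma) * rho ^+ k)%:E)%E.
Proof.
move=> dmax dmin rho nA nSA k.
(* A state-action pair exists because the weights [d] sum to 1. *)
have [p0 _] : exists p0 : S * A, True.
  case: (pickP {: S * A}) => [p _|noSA]; first by exists p.
  have := d_dist.2; rewrite big_pred0 => [/eqP|p].
    by rewrite eq_sym oner_eq0.
  by have := noSA p.
have argmax s : {a | maxf (Qstar s) = Qstar s a}.
  exact: cid (maxfP (Qstar s) p0.2).1.
pose greedy s := sval (argmax s).
have greedyP s : maxf (Qstar s) = Qstar s (greedy s).
  exact: svalP (argmax s).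
have [mX lawX indX] := X_iid.
have lawX' j x : Pr (X j @^-1` [set x]) = (sample_weight P d x)%:E.
  by case: x => [[s a] s']; rewrite lawX.
have g1 : 0 < 1 - gamma by rewrite subr_gt0.
have dmin0 : 0 < dmin by exact: (@dmin_gt0 _ _ _ d d_gt0 p0).
have dmax_min : dmin <= dmax.
  exact: le_trans (@dmin_le _ _ _ d p0 p0) (@dmax_ge _ _ _ d p0).
have dmax1 : dmax <= 1 by apply: (@dmax_le1 _ _ _ d) => //; exact: p0.
have n1 : 1 <= nSA by rewrite ler1n; apply/card_gt0P; exists p0.
have n0 : 0 < nSA by exact: lt_le_trans n1.
set L := ln nA / beta.
have L0 : 0 <= L by exact: (@L_ge0 _ _ _ _ beta_gt0 p0).
pose D := Num.sqrt dmin * ((1 - gamma) * Num.sqrt (1 - gamma)).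
have D0 : 0 < D by rewrite !mulr_gt0 ?sqrtr_gt0.
(* Read off from the goal: its first term is [3 * sigma * dmax / (dmin * (1 - gamma))]. *)
pose sigma := Num.sqrt 6 * Num.sqrt alpha * (1 + L) * nSA / D.
have sigma0 : 0 < sigma.
  by rewrite divr_gt0// !mulr_gt0 ?sqrtr_gt0// ltr_pwDl.
have Ksigma : nSA * (alpha * (2 * ((1 + L) / (1 - gamma))) ^+ 2
    / (dmin * (1 - gamma))) <= sigma ^+ 2.
  have -> : sigma ^+ 2 = nSA * nSA * (6 * alpha * (1 + L) ^+ 2)
      / (dmin * (1 - gamma) ^+ 3).
    rewrite /sigma /D !exprMn exprVn !exprMn !sqr_sqrtr ?ltW//.
    by field; rewrite !gt_eqF.
  rewrite [leLHS](_ : _ = nSA * (4 * alpha * (1 + L) ^+ 2)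
      / (dmin * (1 - gamma) ^+ 3)); last by field; rewrite !gt_eqF.
  have w0 : 0 <= alpha * (1 + L) ^+ 2 by rewrite mulr_ge0 ?sqr_ge0// ltW.
  (* What remains is [4 * nSA <= 6 * nSA ^+ 2] up to a common nonnegative factor, true as
     [nSA >= 1]. *)
  apply: ler_wpM2r; first by rewrite invr_ge0 ltW// mulr_gt0// exprn_gt0.
  rewrite -(mulrA nSA nSA) ler_pM2l//; nra.
pose F t := norm_inf (fun s a =>
  lse_path r gamma alpha beta Q0 t s a - Qstar s a).
have F0 t : 0 <= F t.
  exact: le_trans (normr_ge0 _) (le_supn
    (fun p => lse_path r gamma alpha beta Q0 t p.1 p.2 - Qstar p.1 p.2) p0).
rewrite (_ : (fun w => norm_inf _) = fun w => F (mkseq (X^~ w) k)); last first.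
  by apply/funext => w; rewrite lse_pathE.
rewrite (expectation_mean_path mX lawX' indX k F0).
rewrite lee_fin; apply: le_trans (mean_error P_transition r_bounded d_dist d_gt0
  gamma_ge0 gamma_lt1 alpha_gt0 alpha_lt1 beta_gt0 Q0_bounded Qstar_optimal p0
  greedyP k sigma0 Ksigma) _.
rewrite -/dmax -/dmin -/rho -/L.
have rho0 : 0 < rho.
  exact: (rho_gt0 d_dist d_gt0 gamma_ge0 alpha_gt0 alpha_lt1 p0).
have n32 : 1 <= nSA `^ (3 / 2).
  by rewrite -[leLHS](powRr0 nSA) ler_powR// divr_ge0.
(* At [k = 0] the exponents are -1 and 0, but both sides vanish. *)
have -> : k%:R * rho ^ (k%:Z - 1) = k%:R * rho ^+ k.-1.
  by case: (k) => [|j]; [rewrite !mul0r | rewrite -addn1 PoszD addrK addn1].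
apply: lerD; last first.
  rewrite ler_wpM2r ?exprn_ge0 ?(ltW rho0)// ler_wpM2r ?invr_ge0 ?(ltW g1)//.
  by rewrite ler_peMr.
rewrite -[leRHS]addrA [X in _ <= _ + X]addrC addrA; apply: lerD; last first.
  rewrite ler_wpM2r ?mulr_ge0 ?exprn_ge0 ?(ltW rho0)//.
  rewrite ler_wpM2r ?invr_ge0 ?(ltW g1)// ler_peMr//.
  by rewrite !mulr_ge0 ?(ltW alpha_gt0)// (le_trans (ltW dmin0)).
have -> : 3 * Num.sqrt 6 * alpha `^ (1 / 2) * dmax * (ln nA + beta) * nSA
    / (beta * dmin `^ (3 / 2) * (1 - gamma) `^ (5 / 2)) =
    3 * sigma * dmax / (dmin * (1 - gamma)).
  rewrite (@powR_half_odd _ _ 0)// (@powR_half_odd _ _ 1)//.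
  rewrite (@powR_half_odd _ _ 2)//.
  rewrite /sigma /D /L; field.
  by rewrite !gt_eqF ?sqrtr_gt0.
have -> : ln nA / (beta * dmin * (1 - gamma)) = L / (dmin * (1 - gamma)).
  by rewrite /L; field; rewrite !gt_eqF.
have e0 : 0 < dmin * (1 - gamma) by rewrite mulr_gt0.
(* Since [1 - rho = alpha * dmin * (1 - gamma)], the step size cancels in the quotient. *)
rewrite [leLHS](_ : _ =
   (sigma * (dmin * (1 - gamma)) + gamma * dmax * (L + 2 * sigma)) / (dmin * (1 - gamma))); last first.
  rewrite /rho opprB addrCA subrr addr0; field.
  by rewrite !gt_eqF.
rewrite -mulrDl ler_wpM2r ?invr_ge0 ?(ltW e0)//.
have dmax0 : 0 <= dmax by exact: le_trans (ltW dmin0) dmax_min.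
have h1 : gamma * dmax <= 1 by apply: mulr_ile1 => //; exact: ltW.
(* Source of the constant 3: one [dmax] for the noise itself, two for its effect on the residual. *)
have h2 : dmin * (1 - gamma) + 2 * (gamma * dmax) <= 3 * dmax.
  nra.
have := ler_wpM2r L0 h1; have := ler_wpM2l (ltW sigma0) h2.
lra.
Qed.
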